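(* Let $(K_{1,o},\dots,K_{N,o})$ be the given Nash equilibrium feedback laws of the observed game with dynamics matrices $A,B_1,\dots,B_N$, and write $A_i=A-\sum_{j\ne i}B_jK_{j,o}$. Let symmetric matrices $R_{ii}>0$, $R_{ij}\ge0$ ($j\neq i$), $Q_i^{(0)}\ge 0$ and step sizes $\alpha_i\in(0,1]$ be given for $i,j\in\{1,\dots,N\}$, and let $P_i^{(s+1)}$, $Q_i^{(s+1)}$ be generated by the model-based iteration (defined in the context). Then at each iteration $s=0,1,2,\dots$ and for each $i\in\{1,\dots,N\}$, the feedback law $$K_i=(R_{ii}+B_i^\top P_i^{(s+1)}B_i)^{-1}B_i^\top P_i^{(s+1)}A_i$$ is such that $A_i-B_iK_i$ is stable, i.e. the system $x(k+1)=(A_i-B_iK_i)x(k)$ is asymptotically stable.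
   Context: Notation: for symmetric matrices, $M>0$ and $M\ge 0$ mean positive definite and positive semidefinite. The players are $i\in\mathcal N=\{1,\dots,N\}$. A superscript $(s)$ denotes the value at iteration $s$. Game. The dynamics are $x(k+1)=Ax(k)+\sum_{j=1}^N B_ju_j(k)$ with $x(k)\in\mathbb R^n$, $u_j(k)\in\mathbb R^{m_j}$, $A\in\mathbb R^{n\times n}$, $B_j\in\mathbb R^{n\times m_j}$; the system is assumed stabilizable. Players use feedback laws $u_i(k)=-K_ix(k)$, and admissible profiles are $$\mathcal K=\{(K_1,\dots,K_N): \text{all eigenvalues of } A-\textstyle\sum_{j=1}^N B_jK_j \text{ lie in } \{\lambda\in\mathbb C:|\lambda|<1\}\}.$$ Player $i$ minimizes $J_i=\sum_{t=k}^\infty\big(x^\top(t)Q_ix(t)+\sum_{j=1}^N u_j^\top(t)R_{ij}u_j(t)\big)$ with symmetric $Q_i,R_{ij}$ and $R_{ii}>0$. A profile $(K_1^*,\dots,K_N^* )\in\mathcal K$ is a Nash equilibrium (NE) if for each $i$, each initial state and each $K_i$ with $(K_i,K_{-i}^* )\in\mathcal K$, the cost $J_i$ under $(K_i^*,K_{-i}^* )$ is at most the cost $J_i$ under $(K_i,K_{-i}^* )$, where $K_{-i}^*$ denotes the laws of the other players. Observed game. $(K_{1,o},\dots,K_{N,o})$ is a NE of a game with the dynamics above and unknown symmetric cost parameters $Q_{i,o}\ge 0$, $R_{ij,o}\ge 0$, $R_{ii,o}>0$. In particular $A-\sum_jB_jK_{j,o}=A_i-B_iK_{i,o}$ has all eigenvalues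 in the open unit disc. Model-based iteration. For $s=0,1,2,\dots$ and each $i$, with the $R_{ij}$ kept fixed: $P_i^{(s+1)}$ is the solution of the Stein equation $$Q_i^{(s)}+\sum_{j=1}^N K_{j,o}^\top R_{ij}K_{j,o}-P_i^{(s+1)}+(A_i-B_iK_{i,o})^\top P_i^{(s+1)}(A_i-B_iK_{i,o})=0,$$ and then $$Q_i^{(s+1)}=Q_i^{(s)}+\alpha_i\,\delta_i^{(s+1)\top}(R_{ii}+B_i^\top P_i^{(s+1)}B_i)\,\delta_i^{(s+1)},\quad \delta_i^{(s+1)}=(R_{ii}+B_i^\top P_i^{(s+1)}B_i)^{-1}B_i^\top P_i^{(s+1)}A_i-K_{i,o}.$$ *)

(* Defs.v *)
From HB Require Import structures.
From mathcomp Require Import all_boot all_order all_algebra.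
From mathcomp Require Import complex.
From mathcomp Require Import all_classical all_reals all_analysis.

Set Implicit Arguments.
Unset Strict Implicit.
Unset Printing Implicit Defensive.

Import Order.TTheory GRing.Theory Num.Theory.
Import numFieldNormedType.Exports.
Local Open Scope classical_set_scope.
Local Open Scope ring_scope.

Definition quad (F : realType) (n : nat) (M : 'M[F]_n) (x : 'cV[F]_n) : F :=
  (x^T *m M *m x) 0 0.

Definition posdef (F : realType) (n : nat) (M : 'M[F]_n) : Prop :=
  M^T = M /\ forall x : 'cV[F]_n, x != 0 -> 0 < quad M x.

Definition possemidef (F : realType) (n : nat) (M : 'M[F]_n) : Prop :=
  M^T = M /\ forall x : 'cV[F]_n, 0 <= quad M x.

(* [eigenvalue] refers to row eigenvectors; the spectrum is the usual one.
   The comparison is in [complex F], where `|l| is the (real) modulus. *)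
Definition schur_stable (F : realType) (n : nat) (M : 'M[F]_n) : Prop :=
  forall l : complex F,
    eigenvalue (map_mx (real_complex F) M) l -> `|l| < 1.

(* The solution of x(k+1) = M x(k), x(0) = x0. *)
Definition orbit_of (F : realType) (n : nat) (M : 'M[F]_n) (x0 : 'cV[F]_n)
    (k : nat) : 'cV[F]_n :=
  iter k (mulmx M) x0.

(* Lyapunov stability of the origin together with global attractivity. *)
Definition asymptotically_stable (F : realType) (n : nat) (M : 'M[F]_n) :
    Prop :=
  (forall e : F, 0 < e -> exists2 d : F, 0 < d &
     forall x0 : 'cV[F]_n, `|x0| < d -> forall k, `|orbit_of M x0 k| < e) /\
  (forall x0 : 'cV[F]_n, orbit_of M x0 @ \oo --> (0 : 'cV[F]_n)).

Section Game.
Variables (F : realType) (N n : nat) (m : 'I_N -> nat).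
Variables (A : 'M[F]_n) (B : forall j : 'I_N, 'M[F]_(n, m j)).

Definition profile := forall j : 'I_N, 'M[F]_(m j, n).

Definition admissible (K : profile) : Prop :=
  schur_stable (A - \sum_(j < N) B j *m K j).

(* Stabilizability of (A, [B_1 ... B_N]): some state feedback of all the
   inputs places the spectrum in the open unit disc. *)
Definition stabilizable : Prop := exists K : profile, admissible K.

Definition control (K : profile) (j : 'I_N) (x : 'cV[F]_n) : 'cV[F]_(m j) :=
  - (K j *m x).

(* State at time t >= k under the laws K, started from xk at time k. *)
Definition state (K : profile) (k : nat) (xk : 'cV[F]_n) (t : nat) :
    'cV[F]_n :=
  iter (t - k) (fun x => A *m x + \sum_(j < N) B j *m control K j x) xk.

(* J_i.  The limit of partial sums exists whenever K is admissible, which is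
   the only case in which [cost] is used; otherwise it is a junk value. *)
Definition cost (Qi : 'M[F]_n) (Ri : forall j : 'I_N, 'M[F]_(m j))
    (K : profile) (k : nat) (xk : 'cV[F]_n) : F :=
  limn (fun T : nat => \sum_(k <= t < T)
    (quad Qi (state K k xk t) +
     \sum_(j < N) quad (Ri j) (control K j (state K k xk t)))).

(* [eqtype.dfwith K Ki] is the profile K with the law of player i replaced by Ki. *)
Definition nash_equilibrium (Q : 'I_N -> 'M[F]_n)
    (R : forall i j : 'I_N, 'M[F]_(m j)) (K : profile) : Prop :=
  admissible K /\
  forall (i : 'I_N) (k : nat) (xk : 'cV[F]_n) (Ki : 'M[F]_(m i, n)),
    admissible (eqtype.dfwith K Ki) ->
    cost (Q i) (R i) K k xk <= cost (Q i) (R i) (eqtype.dfwith K Ki) k xk.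

(* A_i: the dynamics seen by player i when the others keep their laws. *)
Definition residual_dynamics (K : profile) (i : 'I_N) : 'M[F]_n :=
  A - \sum_(j < N | j != i) B j *m K j.

Definition input_weight (R : forall i j : 'I_N, 'M[F]_(m j)) (i : 'I_N)
    (P : 'M[F]_n) : 'M[F]_(m i) :=
  R i i + (B i)^T *m P *m B i.

Definition feedback_gain (R : forall i j : 'I_N, 'M[F]_(m j)) (K : profile)
    (i : 'I_N) (P : 'M[F]_n) : 'M[F]_(m i, n) :=
  invmx (input_weight R i P) *m (B i)^T *m P *m residual_dynamics K i.

(* Only P 1, P 2, and so on are constrained; P 0 is unused. *)
Definition model_based_iteration (R : forall i j : 'I_N, 'M[F]_(m j))
    (alpha : 'I_N -> F) (Ko : profile) (Q P : nat -> 'I_N -> 'M[F]_n) :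
    Prop :=
  forall (s : nat) (i : 'I_N),
    let Acl := residual_dynamics Ko i - B i *m Ko i in
    let delta := feedback_gain R Ko i (P s.+1 i) - Ko i in
    Q s i + \sum_(j < N) (Ko j)^T *m R i j *m Ko j
      - P s.+1 i + Acl^T *m P s.+1 i *m Acl = 0 /\
    Q s.+1 i =
      Q s i + alpha i *: (delta^T *m input_weight R i (P s.+1 i) *m delta).

End Game.

(* Main.v *)
(* Write M0 = A_i - B_i K_{i,o} for the observed closed loop, S = R_ii + B_i^T P B_i
   and M = A_i - B_i K for the updated one, K = S^-1 B_i^T P A_i.  As M0 is stable,
   Stein's equation forces P to be positive semidefinite, hence S > 0 and Q stays
   positive semidefinite along the iteration.  Completing the square in Stein's
   equation gives
     P = M^T P M + (K - K_o)^T S (K - K_o) + (positive semidefinite terms).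
   If M v = l v with |l| >= 1, evaluating at v yields (K - K_o) v = 0, so M0 v = l v,
   which contradicts the stability of M0.

   That M^k tends to 0 geometrically when the spectrum lies in the open disc follows
   from Cayley-Hamilton: the factors M - l of the characteristic polynomial are
   peeled off one at a time, X_k = M^k X satisfying
   X_{k+1} = l X_k + M^k (M - l) X with a geometrically small forcing term. *)

Require Import Defs.
From HB Require Import structures.
From mathcomp Require Import all_boot all_order all_algebra.
From mathcomp Require Import complex ring lra.
From mathcomp Require Import all_classical all_reals all_analysis.
Import Order.TTheory GRing.Theory Num.Theory.
Import numFieldNormedType.Exports.
Local Open Scope ring_scope.

Set Implicit Arguments.
Unset Strict Implicit.
Unset Printing Implicit Defensive.

(** * Geometric decay of scalar sequences and matrix powers *)

Lemma decay_le0 (F : realType) (z c r : F) : 0 <= r < 1 ->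
  (forall k, z <= c * r ^+ k) -> z <= 0.
Proof.
move=> /andP[r0 r1] hz.
have h := cvg_geometric c (z := r) _.
have /h{}h : `|r| < 1 by rewrite ger0_norm.
rewrite -(cvg_lim _ h)//; apply: limr_ge; first by apply/cvg_ex; exists 0.
by near=> k; exact: hz.
Unshelve. all: by end_near. Qed.

Lemma decay_recurrence (F : realType) (l r c : F) (a : nat -> F) :
  0 <= l < 1 -> 0 <= r < 1 ->
  (forall k, a k.+1 <= l * a k + c * r ^+ k) ->
  exists c' r', 0 <= r' < 1 /\ forall k, a k <= c' * r' ^+ k.
Proof.
move=> /andP[l0 l1] /andP[r0 r1] ha.
(* [r'] must exceed [l] strictly: for [l = r] a factor [k] appears. *)
pose r' := 1 - (1 - l) * (1 - r) / 2.
have lr' : l < r' by rewrite /r'; nra.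
have rr' : r <= r' by rewrite /r'; nra.
have r'1 : r' < 1 by rewrite /r'; nra.
(* The first summand starts the induction; the second gives [l * c' + |c| <= c' * r'], which closes
   it. *)
pose c' := `|a 0%N| + `|c| / (r' - l).
exists c', r'; split; first by rewrite r'1 andbT; lra.
have cc' : `|c| <= c' * (r' - l).
  rewrite /c' mulrDl divfK ?subr_eq0 ?gt_eqF// lerDr.
  by rewrite mulr_ge0// subr_ge0 ltW.
elim=> [|k IH].
  rewrite expr0 mulr1 /c' (le_trans (ler_norm _))// lerDl divr_ge0//.
  by rewrite subr_ge0 ltW.
apply: (le_trans (ha k)).
have h1 : l * a k <= l * (c' * r' ^+ k) by rewrite ler_wpM2l.
have h2 : c * r ^+ k <= `|c| * r' ^+ k.
  apply: (le_trans (ler_wpM2r _ (ler_norm c))); first by rewrite exprn_ge0.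
  by rewrite ler_wpM2l// lerXn2r// nnegrE//; lra.
have h3 : `|c| * r' ^+ k <= c' * (r' - l) * r' ^+ k.
  by rewrite ler_wpM2r// exprn_ge0//; lra.
rewrite exprS; nra.
Qed.

(** The entrywise l1 norm, valued in [F] rather than [complex F] so that real recurrences apply to
    it. *)
Definition abs_sum (F : realType) n (X : 'M[complex F]_n) : F :=
  \sum_i \sum_j ComplexField.Normc.normc (X i j).

Lemma normcE (F : realType) (x : complex F) :
  `|x| = real_complex F (ComplexField.Normc.normc x).
Proof. by []. Qed.

Lemma normcD_le (F : realType) (x y : complex F) :
  ComplexField.Normc.normc (x + y) <=
  ComplexField.Normc.normc x + ComplexField.Normc.normc y.
Proof. by rewrite -lecR rmorphD -!normcE ler_normD. Qed.

Lemma normc_nneg (F : realType) (x : complex F) :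
  0 <= ComplexField.Normc.normc x.
Proof. by rewrite -ler0c -normcE. Qed.

Lemma abs_sum_lin (F : realType) n (l : complex F) (X Y : 'M[complex F]_n) :
  abs_sum (l *: X + Y) <= ComplexField.Normc.normc l * abs_sum X + abs_sum Y.
Proof.
rewrite /abs_sum mulr_sumr -big_split ler_sum// => i _ /=.
rewrite mulr_sumr -big_split ler_sum// => j _ /=.
by rewrite !mxE -ComplexField.Normc.normcM normcD_le.
Qed.

Lemma row_le_abs_sum (F : realType) n (X : 'M[complex F]_n) i :
  \sum_j ComplexField.Normc.normc (X i j) <= abs_sum X.
Proof.
rewrite /abs_sum [leRHS](bigD1 i)//= lerDl sumr_ge0// => i' _.
by rewrite sumr_ge0// => j _; exact: normc_nneg.
Qed.

(** Letting [X] vary drives the induction: the factor next to [X] is absorbed into it, and the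
    shorter product annihilates [(M - l%:M) * X]. *)
Lemma prod_shift_decay (F : realType) n (M : 'M[complex F]_n.+1)
    (s : seq (complex F)) (X : 'M[complex F]_n.+1) :
  (forall l, l \in s -> `|l| < 1) ->
  (\prod_(l <- s) (M - l%:M)) * X = 0 ->
  exists c r : F, 0 <= r < 1 /\ forall k, abs_sum (M ^+ k * X) <= c * r ^+ k.
Proof.
elim/last_ind: s X => [|s l IH] X hs.
  rewrite big_nil mul1r => ->; exists 0, 0; split; first by rewrite lexx ltr01.
  move=> k; rewrite mulr0 mul0r /abs_sum big1// => i _; rewrite big1// => j _.
  by rewrite mxE ComplexField.Normc.normc0.
rewrite big_rcons/= -mulrA => hX.
have [|c [r [hr hc]]] := IH _ _ hX.
  by move=> l' hl'; apply: hs; rewrite mem_rcons inE hl' orbT.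
apply: (@decay_recurrence _ (ComplexField.Normc.normc l) r c) => //.
  by rewrite normc_nneg -ltcR -normcE hs// mem_rcons inE eqxx.
move=> k.
have -> : M ^+ k.+1 * X = l *: (M ^+ k * X) + M ^+ k * ((M - l%:M) * X).
  rewrite exprSr -!mulrA mulrBl mulrBr.
  by rewrite [l%:M * X]mul_scalar_mx -scalerAr addrC subrK.
by apply: (le_trans (abs_sum_lin _ _ _)); rewrite lerD2l.
Qed.

Lemma power_decay (F : realType) n (M : 'M[complex F]_n.+1) :
  (forall l, eigenvalue M l -> `|l| < 1) ->
  exists c r : F, 0 <= r < 1 /\ forall k, abs_sum (M ^+ k) <= c * r ^+ k.
Proof.
move=> hM.
have [s hs] := closed_field_poly_normal (char_poly M).
rewrite (monicP (char_poly_monic M)) scale1r in hs.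
have [||c [r [hr hc]]] := @prod_shift_decay F n M s 1.
- by move=> l ls; apply: hM; rewrite eigenvalue_root_char hs root_prod_XsubC.
- rewrite mulr1 -(Cayley_Hamilton M) hs rmorph_prod; apply: eq_bigr => l _.
  by rewrite rmorphB /= horner_mx_X horner_mx_C.
by exists c, r; split=> // k; rewrite -[M ^+ k]mulr1.
Qed.

(** * Real orbits and asymptotic stability *)

Lemma le_mx_norm (F : realType) m n (X : 'M[F]_(m, n)) i j : `|X i j| <= `|X|.
Proof.
by rewrite [leRHS]/Num.norm/= mx_normrE; apply/bigmax_geP; right; exists (i, j).
Qed.

Lemma mx_norm_le (F : realType) m n (X : 'M[F]_(m, n)) (c : F) :
  0 <= c -> (forall i j, `|X i j| <= c) -> `|X| <= c.
Proof.
by move=> c0 h; rewrite [leLHS]/Num.norm/= mx_normrE; apply/bigmax_leP; split.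
Qed.

Lemma schur_stable_decay (F : realType) n (M : 'M[F]_n) : schur_stable M ->
  exists c r : F, [/\ 0 <= c, 0 <= r < 1 &
    forall x k, `|orbit_of M x k| <= c * r ^+ k * `|x|].
Proof.
(* Dimension 0 is split off because powers use the ring structure of ['M_n.+1]. *)
case: n M => [|n] M hM.
  exists 0, 0; split; rewrite ?lexx ?ltr01// => x k.
  by rewrite [orbit_of _ _ _]flatmx0 normr0 !mul0r.
have [c [r [hr hc]]] := power_decay hM.
exists `|c|, r; split=> // x k.
have -> : orbit_of M x k = M ^+ k *m x.
  elim: k => [|k IH]; first by rewrite expr0 mul1mx.
  by rewrite exprS -mulmxA -IH.
have [r0 _] := andP hr.
apply: mx_norm_le => [|i j]; first by rewrite !mulr_ge0// exprn_ge0.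
rewrite mxE (le_trans (ler_norm_sum _ _ _))//.
apply: (@le_trans _ _ (abs_sum (map_mx (real_complex F) M ^+ k) * `|x|)).
  apply: le_trans (ler_wpM2r (normr_ge0 _) (row_le_abs_sum _ i)).
  rewrite mulr_suml ler_sum// => l _; rewrite normrM ler_pM ?le_mx_norm//.
  by rewrite -rmorphXn/= mxE /= expr0n/= addr0 sqrtr_sqr.
rewrite ler_wpM2r// (le_trans (hc k))// ler_wpM2r ?exprn_ge0//.
exact: ler_norm.
Qed.

Lemma schur_asymptotically_stable (F : realType) n (M : 'M[F]_n) :
  schur_stable M -> asymptotically_stable M.
Proof.
move=> /schur_stable_decay[c [r [c0 hr hc]]]; have [r0 r1] := andP hr; split.
  (* The denominator is [c + 1] because [c] may vanish. *)
  move=> e e0; exists (e / (c + 1)); first by rewrite divr_gt0// ltr_wpDl.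
  move=> x0; rewrite ltr_pdivlMr ?ltr_wpDl// => hx k.
  apply: le_lt_trans (hc x0 k) _; apply: le_lt_trans hx.
  rewrite mulrC ler_wpM2l// (@le_trans _ _ (c * 1)) ?ler_wpM2l ?exprn_ile1 ?(ltW r1)//.
  by rewrite mulr1 lerDl.
move=> x0; apply/norm_cvg0P.
have h := cvg_geometric (c * `|x0|) (z := r) _.
have /h{}h : `|r| < 1 by rewrite ger0_norm.
apply: (squeeze_cvgr _ (cvg_cst 0) h).
by near=> k; rewrite normr_ge0/= /geometric/= mulrAC hc.
Unshelve. all: by end_near. Qed.

(** * Bilinear forms along orbits *)

Lemma bilinear_le (F : realType) m n (D : 'M[F]_(m, n)) :
  exists2 d : F, 0 <= d &
    forall (x : 'cV[F]_m) (y : 'cV[F]_n),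
      `|(x^T *m D *m y) 0 0| <= d * (`|x| * `|y|).
Proof.
exists (\sum_j \sum_i `|D i j|) => [|x y].
  by rewrite sumr_ge0// => j _; rewrite sumr_ge0.
rewrite mxE (le_trans (ler_norm_sum _ _ _))// mulr_suml ler_sum// => j _.
rewrite mxE mulr_suml (le_trans (ler_norm_sum _ _ _))// mulr_suml ler_sum// => i _.
rewrite mxE !normrM -mulrA mulrCA ler_wpM2l//.
by rewrite ler_pM// le_mx_norm.
Qed.

Lemma stable_bilinear_decay (F : realType) n (M D : 'M[F]_n) (x y : 'cV[F]_n) :
  schur_stable M -> exists c r : F, 0 <= r < 1 /\
    forall k, `|((orbit_of M x k)^T *m D *m orbit_of M y k) 0 0| <= c * r ^+ k.
Proof.
move=> /schur_stable_decay[c [r [c0 /andP[r0 r1] hc]]].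
have [d d0 hd] := bilinear_le D.
exists (d * ((c * `|x|) * (c * `|y|))), (r ^+ 2); split.
  by rewrite exprn_ge0//= exprn_ilt1.
move=> k; apply: le_trans (hd _ _) _.
rewrite -mulrA ler_wpM2l// -exprM mulnC exprM expr2.
apply: (@le_trans _ _ ((c * r ^+ k * `|x|) * (c * r ^+ k * `|y|))).
  by rewrite ler_pM.
by rewrite le_eqVlt; apply/orP; left; apply/eqP; ring.
Qed.

(** * Quadratic forms, semidefiniteness and Stein's equation *)

Lemma quad_congr (F : realType) m n (M : 'M[F]_(m, n)) (P : 'M[F]_m)
    (x : 'cV[F]_n) : quad (M^T *m P *m M) x = quad P (M *m x).
Proof. by rewrite /quad trmx_mul !mulmxA. Qed.

Lemma quadD (F : realType) n (P Q : 'M[F]_n) (x : 'cV[F]_n) :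
  quad (P + Q) x = quad P x + quad Q x.
Proof. by rewrite /quad mulmxDr mulmxDl mxE. Qed.

Lemma quadZ (F : realType) n a (P : 'M[F]_n) (x : 'cV[F]_n) :
  quad (a *: P) x = a * quad P x.
Proof. by rewrite /quad -scalemxAr -scalemxAl mxE. Qed.

Lemma possemidefD (F : realType) n (P Q : 'M[F]_n) :
  possemidef P -> possemidef Q -> possemidef (P + Q).
Proof.
move=> [sP hP] [sQ hQ]; split; first by rewrite linearD /= sP sQ.
by move=> x; rewrite quadD addr_ge0.
Qed.

Lemma possemidefZ (F : realType) n a (P : 'M[F]_n) :
  0 <= a -> possemidef P -> possemidef (a *: P).
Proof.
move=> a0 [sP hP]; split; first by rewrite linearZ /= sP.
by move=> x; rewrite quadZ mulr_ge0.
Qed.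

Lemma possemidef_congr (F : realType) m n (M : 'M[F]_(m, n)) (P : 'M[F]_m) :
  possemidef P -> possemidef (M^T *m P *m M).
Proof.
move=> [sP hP]; split; first by rewrite !trmx_mul trmxK sP mulmxA.
by move=> x; rewrite quad_congr.
Qed.

Lemma possemidef_sum (F : realType) n (I : finType) (p : pred I)
    (f : I -> 'M[F]_n) :
  (forall i, p i -> possemidef (f i)) -> possemidef (\sum_(i | p i) f i).
Proof.
move=> hf; apply: (big_ind (@possemidef F n)) => //; last exact: possemidefD.
by split=> [|x]; rewrite ?trmx0// /quad mulmx0 mul0mx mxE.
Qed.

Lemma posdef_possemidef (F : realType) n (P : 'M[F]_n) :
  posdef P -> possemidef P.
Proof.
move=> [sP hP]; split=> // x; have [->|/hP/ltW//] := eqVneq x 0.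
by rewrite /quad mulmx0 mxE.
Qed.

Lemma posdefD (F : realType) n (P Q : 'M[F]_n) :
  posdef P -> possemidef Q -> posdef (P + Q).
Proof.
move=> [sP hP] [sQ hQ]; split; first by rewrite linearD /= sP sQ.
by move=> x x0; rewrite quadD ltr_wpDr ?hP.
Qed.

Lemma posdef_unit (F : realType) n (P : 'M[F]_n) : posdef P -> P \in unitmx.
Proof.
move=> [sP hP]; rewrite -row_free_unit -kermx_eq0; apply/rowV0P => v.
move/sub_kermxP => vP; apply/eqP/negPn/negP => v0.
have /hP : v^T != 0 by rewrite trmx_eq0.
by rewrite /quad trmxK vP mul0mx mxE ltxx.
Qed.

(** The equation is unrolled along orbits. [P^T - P] solves the homogeneous equation, so its
    bilinear form is constant along pairs of orbits, yet tends to 0. The quadratic form of [P] never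
    increases along an orbit and tends to 0, so it starts nonnegative. *)
Lemma stein_possemidef (F : realType) n (M W P : 'M[F]_n) :
  schur_stable M -> possemidef W -> P = W + M^T *m P *m M -> possemidef P.
Proof.
move=> hM [sW hW] hP; split.
  pose D := P^T - P.
  have hD : D = M^T *m D *m M.
    rewrite /D {1 2}hP linearD /= !trmx_mul trmxK sW mulmxBr mulmxBl mulmxA.
    by rewrite opprD addrACA subrr add0r.
  have hDk k x y : (x^T *m D *m y) 0 0 =
      ((orbit_of M x k)^T *m D *m orbit_of M y k) 0 0.
    elim: k => //= k ->; rewrite {1}hD /orbit_of /=.
    by rewrite trmx_mul !mulmxA.
  suff D0 : D = 0 by apply/eqP; rewrite -subr_eq0 -/D D0.
  apply/matrixP => i j; rewrite [RHS]mxE.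
  have [c [r [hr hc]]] := stable_bilinear_decay D (delta_mx i 0) (delta_mx j 0) hM.
  have -> : D i j = ((delta_mx i 0)^T *m D *m delta_mx j 0 : 'M[F]_1) 0 0.
    by rewrite trmx_delta -rowE -colE !mxE.
  apply/eqP; rewrite -normr_le0; apply: (decay_le0 hr) => k.
  by rewrite (hDk k).
have hq y : quad P y = quad W y + quad P (M *m y).
  by rewrite {1}hP quadD quad_congr.
move=> x; rewrite -oppr_le0.
have [c [r [hr hc]]] := stable_bilinear_decay P x x hM.
apply: (decay_le0 hr) => k; apply: le_trans (hc k).
apply: (@le_trans _ _ (- quad P (orbit_of M x k))); last first.
  by rewrite -normrN ler_norm.
rewrite lerN2; elim: k => //= k; apply: le_trans.
by rewrite [leRHS]hq lerDr.
Qed.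

(* [R u = B^T P p] is the optimality condition that cancels the cross terms. *)
Lemma complete_square (F : realType) m n (R : 'M[F]_m) (P : 'M[F]_n)
    (B : 'M[F]_(n, m)) (p : 'cV[F]_n) (u d : 'cV[F]_m) :
  R^T = R -> P^T = P -> R *m u = B^T *m P *m p ->
  quad P (p + B *m d) + quad R (u - d) =
  quad P p + quad R u + quad (R + B^T *m P *m B) d.
Proof.
move=> sR sP hRu.
have hdu : d^T *m R *m u = d^T *m B^T *m P *m p by rewrite -!mulmxA hRu !mulmxA.
have hud : u^T *m R *m d = p^T *m P *m B *m d.
  by apply: trmx_inj; rewrite !trmx_mul !trmxK sR sP !mulmxA.
rewrite quadD quad_congr /quad ![(_ + _)^T]linearD /= ![(- _)^T]linearN /= !trmx_mul.
rewrite !mulmxDl !mulmxDr !mulNmx !mulmxN !opprK !mulmxA hdu hud !mxE.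
ring.
Qed.

(** * Complex eigenvectors and real quadratic forms *)

Lemma eigenvalue_tr (K : fieldType) n (M : 'M[K]_n) a :
  eigenvalue M^T a = eigenvalue M a.
Proof.
rewrite !eigenvalue_root_char; congr (root _ a).
rewrite /char_poly -[RHS]det_tr; congr (\det _).
by apply/matrixP => i j; rewrite !mxE eq_sym.
Qed.

(** A real matrix acts separately on real and imaginary parts, which brings a complex eigenvector
    within reach of the real form [quad]. *)
Lemma Re_mulmx (F : realType) m n (M : 'M[F]_(m, n)) (v : 'cV[complex F]_n) :
  map_mx (@complex.Re F) (map_mx (real_complex F) M *m v) =
  M *m map_mx (@complex.Re F) v.
Proof.
apply/matrixP => i j; rewrite !mxE.
have add : {morph @complex.Re F : x y / x + y} by case=> ? ? [].
rewrite (big_morph _ add (erefl : complex.Re 0 = 0)).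
by apply: eq_bigr => k _; rewrite !mxE; case: (v k j) => x y /=; ring.
Qed.

Lemma Im_mulmx (F : realType) m n (M : 'M[F]_(m, n)) (v : 'cV[complex F]_n) :
  map_mx (@complex.Im F) (map_mx (real_complex F) M *m v) =
  M *m map_mx (@complex.Im F) v.
Proof.
apply/matrixP => i j; rewrite !mxE.
have add : {morph @complex.Im F : x y / x + y} by case=> ? ? [].
rewrite (big_morph _ add (erefl : complex.Im 0 = 0)).
by apply: eq_bigr => k _; rewrite !mxE; case: (v k j) => x y /=; ring.
Qed.

(** With v = x + iy and l = c + id, this is the real part of (lv)^* P (lv) = |l|^2 v^* P v; the
    cross terms cancel. *)
Lemma quad_rotation (F : realType) n (P : 'M[F]_n) (x y : 'cV[F]_n) (c d : F) :
  quad P (c *: x - d *: y) + quad P (d *: x + c *: y) =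
  (c ^+ 2 + d ^+ 2) * (quad P x + quad P y).
Proof.
rewrite /quad ![(_ + _)^T]linearD /= ![(- _)^T]linearN /= ![(_ *: _)^T]linearZ /=.
rewrite !mulmxDl !mulmxDr !mulNmx !mulmxN -!scalemxAl -!scalemxAr !mxE.
ring.
Qed.

(* An eigenvector of [M] with [`|l| >= 1] is killed by [D] since the Lyapunov
   function [P] cannot increase, so it is an eigenvector of [M0] too. *)
Lemma schur_stable_dissipative (F : realType) m n (M0 M P : 'M[F]_n)
    (B : 'M[F]_(n, m)) (D : 'M[F]_(m, n)) (S : 'M[F]_m) :
  schur_stable M0 -> M = M0 - B *m D -> possemidef P -> posdef S ->
  (forall x, quad S (D *m x) <= quad P x - quad P (M *m x)) ->
  schur_stable M.
Proof.
move=> hM0 hM [_ hP] hSpd hdiss l hl.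
(* [eigenvalue] concerns row vectors; transposing yields the column eigenvector [v] on which the
   dynamics act. *)
have : eigenvalue (map_mx (real_complex F) M)^T l by rewrite eigenvalue_tr.
move=> /eigenvalueP[w hw w0].
pose v := w^T; pose a := map_mx (@complex.Re F) v; pose b := map_mx (@complex.Im F) v.
have hv : map_mx (real_complex F) M *m v = l *: v.
  by apply: trmx_inj; rewrite trmx_mul linearZ /= trmxK.
have ha : M *m a = complex.Re l *: a - complex.Im l *: b.
  rewrite -Re_mulmx hv; apply/matrixP => i j; rewrite !mxE.
  by case: l {hl hw hv} => ? ?; case: (w j i).
have hb : M *m b = complex.Im l *: a + complex.Re l *: b.
  rewrite -Im_mulmx hv; apply/matrixP => i j; rewrite !mxE.
  by case: l {hl hw hv ha} => ? ?; case: (w j i) => ? ? /=; ring.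
have S_ge0 x : 0 <= quad S x by have [_ ->] := posdef_possemidef hSpd.
have D0 x : quad S (D *m x) <= 0 -> D *m x = 0.
  by move=> h; apply/eqP/negPn/negP => /(hSpd.2); rewrite ltNge h.
have lE : (`|l| < 1) = ~~ (1 <= complex.Re l ^+ 2 + complex.Im l ^+ 2).
  by rewrite normc_def ltcR ltNge -[X in X <= _]sqrtr1 ler_sqrt ?addr_ge0 ?sqr_ge0.
rewrite lE; apply/negP => hl1.
(* Adding the dissipation inequalities at [a] and [b] bounds the left side by (1 - |l|^2)
   ([quad P a + quad P b]). *)
have hab : quad S (D *m a) + quad S (D *m b) <= 0.
  apply: le_trans (lerD (hdiss a) (hdiss b)) _.
  rewrite addrACA -opprD ha hb quad_rotation.
  have := hP a; have := hP b; nra.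
have Dv : map_mx (real_complex F) D *m v = 0.
  have Da : D *m a = 0 by apply: D0; have := S_ge0 (D *m b); lra.
  have Db : D *m b = 0 by apply: D0; have := S_ge0 (D *m a); lra.
  move: Da Db; rewrite -Re_mulmx -Im_mulmx.
  move: (_ *m v) => X /matrixP ReX /matrixP ImX; apply/matrixP => i j.
  by have := ReX i j; have := ImX i j; rewrite !mxE; case: (X i j) => x y /= -> ->.
have : `|l| < 1.
  apply: hM0; rewrite -eigenvalue_tr; apply/eigenvalueP; exists w => //.
  apply: trmx_inj; rewrite trmx_mul trmxK linearZ /= -/v -hv hM.
  by rewrite map_mxB map_mxM mulmxBl -mulmxA Dv mulmx0 subr0.
by rewrite lE hl1.
Qed.

(** * Stability of the updated closed loop *)

Theorem theorem3 (F : realType) (N n : nat) (m : 'I_N -> nat)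
  (A : 'M[F]_n) (B : forall j : 'I_N, 'M[F]_(n, m j))
  (hstab : stabilizable A B)
  (Qo : 'I_N -> 'M[F]_n) (Ro : forall i j : 'I_N, 'M[F]_(m j))
  (hQo : forall i, possemidef (Qo i))
  (hRo : forall i j, possemidef (Ro i j))
  (hRoii : forall i, posdef (Ro i i))
  (Ko : forall j : 'I_N, 'M[F]_(m j, n))
  (hKo : nash_equilibrium A B Qo Ro Ko)
  (R : forall i j : 'I_N, 'M[F]_(m j))
  (hRii : forall i, posdef (R i i))
  (hRij : forall i j, j != i -> possemidef (R i j))
  (alpha : 'I_N -> F)
  (halpha : forall i, 0 < alpha i <= 1)
  (Q P : nat -> 'I_N -> 'M[F]_n)
  (hQ0 : forall i, possemidef (Q 0%N i))
  (hiter : model_based_iteration A B R alpha Ko Q P) :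
  forall (s : nat) (i : 'I_N),
    let Ai := residual_dynamics A B Ko i in
    let Ki := feedback_gain A B R Ko i (P s.+1 i) in
    schur_stable (Ai - B i *m Ki) /\ asymptotically_stable (Ai - B i *m Ki).
Proof.
move=> s i Ai Ki.
suff h : schur_stable (Ai - B i *m Ki).
  by split=> //; exact: schur_asymptotically_stable.
have hcl : schur_stable (Ai - B i *m Ko i).
  have [hadm _] := hKo; suff <- : A - \sum_j B j *m Ko j = Ai - B i *m Ko i by [].
  by rewrite (bigD1 i)//= opprD addrA addrAC.
have hR j : possemidef (R i j).
  by have [->|/hRij//] := eqVneq j i; exact: posdef_possemidef.
(* Conditional on [Q t i], since [Q t.+1 i] is built from [P t.+1 i]; the induction proving [hQ]
   discharges the condition. *)
have hP t : possemidef (Q t i) -> possemidef (P t.+1 i).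
  move=> hQ; have [stein _] := hiter t i.
  apply: (stein_possemidef hcl (possemidefD hQ (possemidef_sum _))).
    by move=> j _; exact: possemidef_congr (hR j).
  by apply/esym/eqP; rewrite -subr_eq0 addrAC; apply/eqP/stein.
have hS t : possemidef (Q t i) -> posdef (input_weight B R i (P t.+1 i)).
  by move=> hQ; apply: posdefD => //; apply/possemidef_congr/hP.
have hQ t : possemidef (Q t i).
  elim: t => // t IH; have [_ ->] := hiter t i.
  apply: possemidefD => //; apply: possemidefZ.
    by have /andP[/ltW] := halpha i.
  exact/possemidef_congr/posdef_possemidef/hS.
have Spos := hS s (hQ s); have Ppsd := hP s (hQ s).
have [stein _] := hiter s i; rewrite -/Ai in stein.
have hSK : input_weight B R i (P s.+1 i) *m Ki = (B i)^T *m P s.+1 i *m Ai.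
  by rewrite /Ki /feedback_gain !mulmxA mulmxV ?posdef_unit// mul1mx.
(* From here on [Ki] is known only through its normal equation [hSK]. *)
clearbody Ki; clearbody Ai.
apply: (schur_stable_dissipative (B := B i) (D := Ki - Ko i) hcl _ Ppsd Spos).
  by rewrite mulmxBr opprB addrA subrK.
move=> x.
(* Removing the [B^T P B K] term from both sides of [hSK] gives the optimality condition for
   [complete_square], at [u = K x], [p = M x] and [d = (K - K_o) x]. *)
have hRK : R i i *m (Ki *m x) =
    (B i)^T *m P s.+1 i *m ((Ai - B i *m Ki) *m x).
  rewrite !mulmxA; congr (_ *m x).
  by rewrite mulmxBr -hSK /input_weight mulmxDl !mulmxA addrK.
have := complete_square ((Ki - Ko i) *m x) (proj1 (hRii i)) (proj1 Ppsd) hRK.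
rewrite -/(input_weight B R i (P s.+1 i)).
have -> : (Ai - B i *m Ki) *m x + B i *m ((Ki - Ko i) *m x) =
    (Ai - B i *m Ko i) *m x.
  by rewrite mulmxA -mulmxDl mulmxBr addrA subrK.
have -> : Ki *m x - (Ki - Ko i) *m x = Ko i *m x.
  by rewrite mulmxBl opprB addrCA subrr addr0.
(* The term [j = i] is isolated because [complete_square] produces the same
   [quad (R i i) (Ko i *m x)], which then cancels. *)
have : quad (P s.+1 i) x = quad (Q s i) x +
    (quad (R i i) (Ko i *m x) +
     quad (\sum_(j | j != i) (Ko j)^T *m R i j *m Ko j) x) +
    quad (P s.+1 i) ((Ai - B i *m Ko i) *m x).
  rewrite -!quad_congr -!quadD; congr (quad _ x).
  move: stein; rewrite (bigD1 i)//= => stein.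
  by apply/esym/eqP; rewrite -subr_eq0 addrAC stein.
(* The decrease of [P] exceeds [quad S (D x)] by exactly the three terms whose nonnegativity
   follows. *)
have := (hQ s).2 x.
have := (possemidef_sum (p := fun j => j != i)
  (fun j _ => possemidef_congr (Ko j) (hR j))).2 x.
have := (posdef_possemidef (hRii i)).2 (Ki *m x).
lra.
Qed.
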